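(* (ZFC) There is a set $C\subseteq[\omega]^\omega$ which has the Ramsey property but is not dual-Ramsey, in the sense that the set $\{X\in(\omega)^\omega:\mathrm{pac}(X)\in C\}$ does not have the dual-Ramsey property.
   Context: $[\omega]^\omega$ is the set of infinite subsets of $\omega$; for $x\in[\omega]^\omega$, $[x]^\omega$ is the set of infinite subsets of $x$. $C\subseteq[\omega]^\omega$ has the Ramsey property if there is $x\in[\omega]^\omega$ with $[x]^\omega\subseteq C$ or $[x]^\omega\cap C=\emptyset$. A partition of $\omega$ is a set of nonempty pairwise disjoint subsets (blocks) of $\omega$ whose union is $\omega$; $(\omega)^\omega$ is the set of partitions with infinitely many blocks. For partitions $X,Y$, $Y\sqsubseteq X$ means every block of $Y$ is a union of blocks of $X$; $(X)^\omega=\{Y\in(\omega)^\omega:Y\sqsubseteq X\}$. $A\subseteq(\omega)^\omega$ has the dual-Ramsey property if some $X\in(\omega)^\omega$ satisfies $(X)^\omega\subseteq A$ or $(X)^\omega\cap A=\emptyset$. For $n\neq m$ let $\flat\{n,m\}=\frac12(\max\{n,m\}^2-\max\{n,m\})+\min\{n,m\}$; the partition code of a partition $P$ is $\mathrm{pac}(P)=\{\flat\{n,m\}: n\neq m \text{ and } n,m \text{ lie in different blocks of } P\}$. *)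

(* Defs.v *)
From mathcomp Require Import all_boot.
From mathcomp Require Import classical_sets cardinality.

Set Implicit Arguments.
Unset Strict Implicit.
Unset Printing Implicit Defensive.

Local Open Scope classical_set_scope.

Definition inf_subsets (x : set nat) : set (set nat) :=
  [set y | y `<=` x /\ infinite_set y].

(* The ambient assumption C `<=` inf_subsets [set: nat] is not included. *)
Definition Ramsey (C : set (set nat)) : Prop :=
  exists x, inf_subsets [set: nat] x /\
    (inf_subsets x `<=` C \/ inf_subsets x `&` C = set0).

(* A partition of nat is the set P of its blocks, that is, the family of sets
   indexed by P itself through the identity. *)
Definition inf_partitions : set (set (set nat)) :=
  [set P | partition P id [set: nat] /\ infinite_set P].

Definition coarser (Y X : set (set nat)) : Prop :=
  forall B, Y B -> exists F : set (set nat), F `<=` X /\ B = \bigcup_(A in F) A.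

Definition inf_coarsenings (X : set (set nat)) : set (set (set nat)) :=
  [set Y | inf_partitions Y /\ coarser Y X].

(* The ambient assumption A `<=` inf_partitions is not included. *)
Definition dual_Ramsey (A : set (set (set nat))) : Prop :=
  exists X, inf_partitions X /\
    (inf_coarsenings X `<=` A \/ inf_coarsenings X `&` A = set0).

(* Both the subtraction and the division are exact, as k ^ 2 - k is a
   nonnegative even number. *)
Definition flat (n m : nat) : nat :=
  (maxn n m ^ 2 - maxn n m) %/ 2 + minn n m.

Definition in_different_blocks (P : set (set nat)) (n m : nat) : Prop :=
  exists A B, [/\ P A, P B, A <> B, A n & B m].

Definition pac (P : set (set nat)) : set nat :=
  [set k | exists n m, [/\ n <> m, in_different_blocks P n m & k = flat n m]].

(* Main.v *)
Require Import Defs.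
From mathcomp Require Import all_boot.
From mathcomp Require Import classical_sets cardinality.
From mathcomp Require Import boolp.

Local Open Scope classical_set_scope.

(** Send every infinite partition [X] to a proper coarsening [f X] that is again
an infinite partition. As coarsening is antisymmetric, [f] has no cycles, so
choosing a representative in every class of the relation "[X] and [Y] have a
common iterate under [f]" and counting steps modulo 2 gives a set [c] of
partitions containing exactly one of [X] and [f X], for every [X]; such a set is
not dual-Ramsey. Let [C] be the set of codes of the members of [c]. Viewed as a
graph, the code of an infinite partition is complete multipartite with
infinitely many parts, so it has an edge that avoids the vertex [0]; hence no
subset of the star [{flat 0 k : k > 0}] is a code, and [C] is Ramsey. *)

(** * Two-colourings along the orbits of a map *)

Lemma parity_coloring (T : choiceType) (D : set T) (f : T -> T) :
  (forall x, D x -> D (f x)) ->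
  (forall x n, D x -> odd n -> iter n f x <> x) ->
  exists c : set T, forall x, D x -> (c (f x) <-> ~ c x).
Proof.
move=> fD acyc.
have iD n x : D x -> D (iter n f x) by move=> Dx; elim: n => //= n /fD.
pose R x y := exists n m, iter n f x = iter m f y.
have Rsym x y : R x y -> R y x by move=> [n [m e]]; exists m, n.
have Rtrans x y z : R x y -> R y z -> R x z.
  move=> [n [m e]] [p [q e']]; exists (p + n), (m + q).
  by rewrite iterD e -iterD addnC iterD e' -iterD.
pose rep x := xget x (R x).
have Rrep x : R x (rep x).
  by apply: (@xgetPex _ x (R x)); exists x, 0, 0.
have Rf x : R x (f x) by exists 1, 0.
have repf x : rep (f x) = rep x.
  have E : R (f x) = R x.
    by apply/seteqP; split=> z; apply: Rtrans => //; exact: Rsym.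
  (* The choice depends on the class only: the differing defaults [f x] and [x] would matter just
     for an empty class. *)
  rewrite /rep E /xget; case: pselect => // nR.
  by exfalso; apply: nR; exists (f x); apply/asboolP.
(* Two meetings of the orbits of [x] and [y] whose parities differ would close up to a cycle of odd
   length [n + q - (p + m)]. *)
have parity x y n m p q : D x -> iter n f x = iter m f y ->
    iter p f x = iter q f y -> odd (n + m) = odd (p + q).
  move=> Dx; wlog le : n m p q / p + m <= n + q.
    move=> W e e'; case/orP: (leq_total (p + m) (n + q)) => l; first exact: W.
    by apply/esym; apply: W.
  move=> e e'.
  have E : iter (n + q) f y = iter (p + m) f y.
    by rewrite iterD -e' -iterD addnC iterD e -iterD.
  apply/eqP/negPn/negP => ne.
  apply: (acyc (iter (p + m) f y) (n + q - (p + m))).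
  - by rewrite iterD -e -iterD; exact: iD.
  - rewrite oddB //; move: ne; rewrite !oddD.
    by case: (odd n); case: (odd m); case: (odd p); case: (odd q).
  - by rewrite -iterD subnK.
exists [set x | exists n m, iter n f x = iter m f (rep x) /\ odd (n + m)] => x Dx.
rewrite /= repf; have [p [q e]] := Rrep x; split.
  move=> [n [m [e1 o1]]] [n' [m' [e2 o2]]].
  rewrite -iterSr in e1.
  by have := parity _ _ _ _ _ _ Dx e1 e2; rewrite o2 addSn /= o1.
(* One more step on the side of [rep x] turns a meeting with [x] into a meeting with [f x] of the
   other parity. *)
move=> nc; exists p, q.+1; rewrite -iterSr !iterS e; split=> //.
by rewrite addnS /=; apply/negP => o; apply: nc; exists p, q.
Qed.

(** * Coding of unordered pairs *)

Lemma flatE n m : flat n m = 'C(maxn n m, 2) + minn n m.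
Proof.
rewrite /flat bin2 -divn2; congr (_ %/ 2 + _); case: maxn => // k.
by rewrite -mulnn mulnS addKn mulnC.
Qed.

(** Pairs with maximum [b] are coded between ['C(b, 2)] and ['C(b.+1, 2)], the latter excluded;
    these intervals are disjoint for distinct [b]. *)
Lemma flat_inj n m n' m' : n <> m -> n' <> m' -> flat n m = flat n' m' ->
  (n = n' /\ m = m') \/ (n = m' /\ m = n').
Proof.
have step a b : a < b -> 'C(b, 2) + a < 'C(b.+1, 2).
  by move=> ab; rewrite binS bin1 ltn_add2l.
have mono a b : a <= b -> 'C(a, 2) <= 'C(b, 2).
  exact: leq_bin2l.
have ord a b a' b' : a < b -> a' < b' ->
    'C(b, 2) + a = 'C(b', 2) + a' -> a = a' /\ b = b'.
  move=> ab ab' e; have [bb'|bb'|bb'] := ltngtP b b'.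
  - have := leq_trans (step _ _ ab) (mono _ _ bb').
    by rewrite e ltnNge leq_addr.
  - have := leq_trans (step _ _ ab') (mono _ _ bb').
    by rewrite -e ltnNge leq_addr.
  - by move: e; rewrite bb' => /addnI.
move=> /eqP + /eqP; rewrite !flatE.
case: ltngtP => // l _; case: ltngtP => // l' _ /ord[] // -> ->; auto.
Qed.

(** * Partitions and the points they separate *)

Lemma block_eq {P A B n} : inf_partitions P -> P A -> P B -> A n -> B n -> A = B.
Proof. by move=> [[_ + _] _] PA PB An Bn; apply => //; exists n. Qed.

Lemma block_ex {P} n : inf_partitions P -> exists2 A, P A & A n.
Proof.
by move=> [[+ _ _] _] => /seteqP[_ /(_ n I)] [A PA An]; exists A.
Qed.

Lemma fresh_block P (F : set (set nat)) : inf_partitions P -> finite_set F ->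
  exists A n, [/\ P A, ~ F A & A n].
Proof.
move=> [[_ _ ne] infP] finF.
have [A [PA FA]] := infinite_setN0 (infinite_setD infP finF).
by have [n An] := ne A PA; exists A, n.
Qed.

Lemma in_different_blocks_pac P n m : inf_partitions P ->
  in_different_blocks P n m <-> n <> m /\ pac P (flat n m).
Proof.
move=> pP; split.
  move=> dnm; have nm : n <> m.
    case: dnm => A [B [PA PB AB An Bm]] e; apply: AB.
    by apply: (block_eq pP PA PB An); rewrite e.
  by split=> //; exists n, m.
move=> [nm [n' [m' [nm' [A [B [PA PB AB An Bm]]] e]]]].
case: (flat_inj _ _ _ _ nm nm' e) => -[-> ->].
- by exists A, B.
- by exists B, A; split=> // /esym.
Qed.

(** The block of [n] can be recovered as the set of points not separated from [n]. *)
Lemma in_different_blocks_inj X Y : inf_partitions X -> inf_partitions Y ->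
  in_different_blocks X = in_different_blocks Y -> X = Y.
Proof.
have blockE P A n m : inf_partitions P -> P A -> A n ->
    A m <-> ~ in_different_blocks P n m.
  move=> pP PA An; split.
    move=> Am [B [C [PB PC BC Bn Cm]]]; apply: BC.
    by rewrite -(block_eq pP PA PB An Bn) (block_eq pP PA PC Am Cm).
  move=> nd; have [B PB Bm] := block_ex m pP.
  have [-> //|AB] := pselect (A = B).
  by case: nd; exists A, B.
have sub P Q : inf_partitions P -> inf_partitions Q ->
    in_different_blocks P = in_different_blocks Q -> P `<=` Q.
  move=> pP pQ E A PA.
  have [n An] : A !=set0 by case: pP => -[_ _ ne] _; exact: ne.
  have [B QB Bn] := block_ex n pQ.
  suff -> : A = B by [].
  apply/seteqP; split=> m.
  - by move=> /(blockE _ _ _ _ pP PA An); rewrite E => /(blockE _ _ _ _ pQ QB Bn).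
  - by move=> /(blockE _ _ _ _ pQ QB Bn); rewrite -E => /(blockE _ _ _ _ pP PA An).
by move=> pX pY E; apply/seteqP; split; apply: sub.
Qed.

Lemma pac_inj X Y : inf_partitions X -> inf_partitions Y -> pac X = pac Y -> X = Y.
Proof.
move=> pX pY e; apply: in_different_blocks_inj => //.
apply/funext => n; apply/funext => m; apply/propext.
by rewrite !in_different_blocks_pac // e.
Qed.

(** * Coarsenings and a set that is not dual-Ramsey *)

Lemma coarser_in_different_blocks X Y n m : inf_partitions Y -> coarser Y X ->
  in_different_blocks Y n m -> in_different_blocks X n m.
Proof.
move=> pY YX [A [B [YA YB AB An Bm]]].
have [F [FX EA]] := YX A YA; have [G [GX EB]] := YX B YB.
move: (An) (Bm); rewrite {1}EA {1}EB => -[A' FA' An'] [B' GB' Bm'].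
exists A', B'; split; [exact: FX|exact: GX| |by []|by []] => e.
apply: AB; apply: (block_eq pY YA YB An).
by rewrite EB; exists B' => //; rewrite -e.
Qed.

Lemma coarser_refl X : coarser X X.
Proof. by move=> B XB; exists [set B]; rewrite bigcup_set1; split=> // ? ->. Qed.

(** Two blocks are merged; all but finitely many blocks survive, so infinitely many remain. *)
Lemma proper_coarsening X : inf_partitions X ->
  exists2 Y, inf_coarsenings X Y & Y <> X.
Proof.
move=> pX.
have [A [a [XA _ Aa]]] := fresh_block X set0 pX (finite_set0 _).
have [B [b [XB BA Bb]]] := fresh_block X [set A] pX (finite_set1 _).
have AB : A <> B by move=> e; apply: BA; rewrite e.
pose Y : set (set nat) := (A `|` B) |` (X `\` [set A; B]).
have pY : inf_partitions Y.
  split; last first.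
    move=> finY; have [_ infX] := pX.
    have := infinite_setD infX (finite_set2 A B); apply.
    by apply: sub_finite_set finY; exact: subsetUr.
  have disj C : (X `\` [set A; B]) C -> (A `|` B) `&` C !=set0 -> False.
    move=> [XC nC] [n [[An|Bn] Cn]]; apply: nC.
    - by left; rewrite (block_eq pX XA XC An Cn).
    - by right; rewrite (block_eq pX XB XC Bn Cn).
  split.
  - apply/seteqP; split=> // n _; have [C XC Cn] := block_ex n pX.
    have [[eC|eC]|nC] := pselect ([set A; B] C).
    + by exists (A `|` B); [left | left; rewrite -eC].
    + by exists (A `|` B); [left | right; rewrite -eC].
    + by exists C => //; right.
  - move=> C C' [eC|YC] [eC'|YC'].
    + by rewrite eC.
    + by rewrite eC => /(disj _ YC').
    + by rewrite eC' setIC => /(disj _ YC).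
    + by move=> [n [Cn Cn']]; exact: (block_eq pX YC.1 YC'.1 Cn Cn').
  - move=> C [->|[XC _]]; first by exists a; left.
    by case: pX => -[_ _ ne] _; exact: ne.
exists Y; first split=> //.
  move=> C [->|[XC _]]; last exact: coarser_refl.
  exists [set A; B]; rewrite bigcup_setU !bigcup_set1; split=> //.
  by move=> ? [->|->].
move=> e; have XU : X (A `|` B) by rewrite -e; left.
apply: AB; transitivity (A `|` B).
- by apply: (block_eq pX XA XU Aa); left.
- by apply: (block_eq pX XU XB _ Bb); right.
Qed.

(** Both [X] and [f X] lie in [inf_coarsenings X], and the colouring tells them apart, so no [X] is
    homogeneous. *)
Lemma not_dual_Ramsey_ex : exists c : set (set (set nat)),
  c `<=` inf_partitions /\ ~ dual_Ramsey c.
Proof.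
have [f fP] : {f : set (set nat) -> set (set nat) & forall X,
    inf_partitions X -> inf_coarsenings X (f X) /\ f X <> X}.
  apply: (choice (P := fun X Y => inf_partitions X -> inf_coarsenings X Y /\ Y <> X)).
  move=> X; have [pX|npX] := pselect (inf_partitions X); last by exists X.
  by have [Y] := proper_coarsening X pX; exists Y.
have fD X : inf_partitions X -> inf_partitions (f X) by move=> /fP[[]].
have iD n X : inf_partitions X -> inf_partitions (iter n f X).
  by move=> pX; elim: n => //= n /fD.
have sub n X : inf_partitions X -> forall a b,
    in_different_blocks (iter n f X) a b -> in_different_blocks X a b.
  move=> pX a b; elim: n => //= n IH d; apply: IH; move: d.
  have pn := iD n X pX; have [[pf ff] _] := fP _ pn.
  exact: coarser_in_different_blocks.
(* Coarsening only loses separated pairs, so along a cycle none is lost and already [f X] would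
   equal [X]. *)
have acyc X n : inf_partitions X -> odd n -> iter n f X <> X.
  case: n => // n pX _; rewrite iterSr => e.
  have [_] := fP X pX; apply.
  apply: in_different_blocks_inj => //; first exact: fD.
  apply/funext => a; apply/funext => b; apply/propext; split.
  - exact: (sub 1).
  - by rewrite -{1}e; apply: sub; exact: fD.
have [c cP] := parity_coloring _ _ _ fD acyc.
(* The colouring is controlled on infinite partitions only, hence the intersection. *)
exists (inf_partitions `&` c); split; first exact: subIsetl.
move=> [X [pX]]; have [fX _] := fP X pX; have pf := fD X pX.
have XX : inf_coarsenings X X by split=> //; exact: coarser_refl.
have := cP X pX; case=> c1 c2 [S|S].
  by apply: c1; [exact: (S _ fX).2 | exact: (S _ XX).2].
have nS Y : inf_coarsenings X Y -> ~ c Y.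
  move=> XY cY; have : (inf_coarsenings X `&` (inf_partitions `&` c)) Y.
    by split=> //; split=> //; exact: XY.1.
  by rewrite S.
by apply: (nS _ fX); apply: c2; exact: nS.
Qed.

(** * Codes of infinite partitions and the star at [0] *)

Lemma infinite_pac P : inf_partitions P -> infinite_set (pac P).
Proof.
move=> pP; have [A PA A0] := block_ex 0 pP.
have ne B : P B -> B (xget 0 B).
  by move=> PB; apply: xgetPex; case: pP => -[_ _ /(_ B PB) ?].
have nz B : (P `\` [set A]) B -> 0 <> xget 0 B.
  move=> [PB BA] e; apply: BA; apply: (block_eq pP PB PA _ A0).
  by rewrite e; exact: ne.
(* Each block other than that of [0] contributes the edge from [0] to a chosen point of it; blocks
   being nonempty, the default of [xget] never intervenes. *)
have inj : {in P `\` [set A] &, injective (fun B => flat 0 (xget 0 B))}.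
  move=> B C; rewrite !inE => PB PC e.
  have [[_ E]|[E _]] := flat_inj _ _ _ _ (nz _ PB) (nz _ PC) e; last first.
    by case: (nz _ PC).
  apply: (block_eq pP PB.1 PC.1 (ne _ PB.1)).
  by rewrite E; exact: ne PC.1.
move=> fin; have := infinite_setD pP.2 (finite_set1 A); apply.
rewrite -(eq_finite_set (inj_card_eq inj)).
apply: sub_finite_set fin => k [B [PB BA] <-].
exists 0, (xget 0 B); split=> //; first exact: nz.
by exists A, B; split=> //; [exact/nesym | exact: ne].
Qed.

Lemma pac_not_star P : inf_partitions P ->
  ~ pac P `<=` range (fun k => flat 0 k.+1).
Proof.
move=> pP S; have [A PA A0] := block_ex 0 pP.
have [B [b [PB BA Bb]]] := fresh_block P [set A] pP (finite_set1 _).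
have [C [c [PC CAB Cc]]] := fresh_block P [set A; B] pP (finite_set2 _ _).
have BC : B <> C by move=> e; apply: CAB; right.
have b0 : b <> 0.
  by move=> e; apply: BA; apply: (block_eq pP PB PA Bb); rewrite e.
have c0 : c <> 0.
  by move=> e; apply: CAB; left; apply: (block_eq pP PC PA Cc); rewrite e.
(* The edge between [b] and [c] belongs to the code, yet neither end is [0]. *)
have [bc /S[k _ e]] : b <> c /\ pac P (flat b c).
  by apply/in_different_blocks_pac => //; exists B, C.
have k0 : 0 <> k.+1 by [].
by have [[/esym]|[/esym]] := flat_inj _ _ _ _ k0 bc e.
Qed.

Theorem theorem7p1 :
  exists C : set (set nat),
    [/\ C `<=` inf_subsets [set: nat],
        Ramsey C
      & ~ dual_Ramsey [set X | inf_partitions X /\ C (pac X)]].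
Proof.
have [c [cP nc]] := not_dual_Ramsey_ex.
exists (pac @` c); split.
- by move=> _ [X cX <-]; split=> //; apply/infinite_pac/cP.
- exists (range (fun k => flat 0 k.+1)); split.
    split=> //; rewrite (eq_finite_set (inj_card_eq _)).
      by move/infinite_nat.
    move=> n m _ _ e; have n0 k : 0 <> k.+1 by [].
    by have [[_ []]|[]] := flat_inj _ _ _ _ (n0 n) (n0 m) e.
  right; apply/seteqP; split=> // k [[S _] [X cX e]].
  by apply: (pac_not_star X (cP X cX)); rewrite e.
(* Since [pac] is injective on infinite partitions, pulling the image of [c] back gives exactly
   [c]. *)
- suff -> : [set X | inf_partitions X /\ (pac @` c) (pac X)] = c by [].
  apply/seteqP; split=> X.
    move=> [pX [Y cY e]]; rewrite -(pac_inj Y X) //; exact: cP.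
  by move=> cX; split; [exact: cP | exists X].
Qed.
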